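(* Let $f$ be an isomorphism-invariant monic graph polynomial of exponential type, written $f(G,x)=\sum_{k=0}^n(-1)^k e_k(G)x^{n-k}$ with $n=|V(G)|$, and for $k\ge1$ let $p_k(G)$ be the $k$-th power sum of the roots of $f(G,x)$ (with multiplicity). Let $k\ge1$. (a) $e_k$ is a finite complex linear combination of functions $H(\cdot)$ with $H$ ranging over graphs satisfying $k+1\le|V(H)|\le 2k$ and $|V(H)|-k(H)\le k$; and $p_k$ is a finite complex linear combination of functions $H(\cdot)$ with $H$ ranging over graphs satisfying $2\le|V(H)|\le 2k$ and $|V(H)|-k(H)\le k$. (b) If moreover $f$ is multiplicative, then $e_k$ is a finite complex linear combination of functions $H(\cdot)$ with $H$ ranging over graphs without isolated vertices satisfying $|V(H)|-k(H)=k$, and $p_k$ is a finite complex linear combination of functions $H(\cdot)$ with $H$ ranging over connected graphs satisfying $2\le|V(H)|\le k+1$.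
   Context: All graphs are finite simple graphs. A graph polynomial assigns to each graph $G$ a polynomial $f(G,x)\in\mathbb{C}[x]$; it is monic if $f(G,x)$ is monic of degree $|V(G)|$; isomorphism-invariant if $G_1\cong G_2$ implies $f(G_1,x)=f(G_2,x)$; multiplicative if $f(G_1\uplus G_2,x)=f(G_1,x)f(G_2,x)$ for disjoint unions; of exponential type if $f(\emptyset,x)=1$ and $\sum_{S\subseteq V(G)}f(G[S],x)f(G[V(G)\setminus S],y)=f(G,x+y)$ for every graph $G$ ($G[S]$ the induced subgraph). $H(G)$ denotes the number of (not necessarily induced) subgraphs of $G$ isomorphic to $H$, and $k(H)$ the number of connected components of $H$. *)

(* Defs.v *)
From HB Require Import structures.
From mathcomp Require Import all_boot all_order all_algebra.
From mathcomp Require Import boolp reals complex.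

Set Implicit Arguments.
Unset Strict Implicit.
Unset Printing Implicit Defensive.

Import GRing.Theory.
Local Open Scope ring_scope.

Record sgraph := SGraph {
  vertex :> finType;
  adj : rel vertex;
  adj_sym : symmetric adj;
  adj_irrefl : irreflexive adj }.

Arguments adj {s}.

Definition sgraph_iso (G H : sgraph) : Prop :=
  exists2 h : G -> H, bijective h & forall x y, adj (h x) (h y) = adj x y.

Section EmptyGraph.
Let void_adj (x y : void) := false.
Fact void_adj_sym : symmetric void_adj. Proof. by []. Qed.
Fact void_adj_irrefl : irreflexive void_adj. Proof. by []. Qed.
Definition empty_graph := SGraph void_adj_sym void_adj_irrefl.
End EmptyGraph.

Section DisjointUnion.
Variables G1 G2 : sgraph.
Let union_adj (x y : G1 + G2) :=
  match x, y with
  | inl a, inl b => adj a b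
  | inr a, inr b => adj a b
  | _, _ => false
  end.
Fact union_adj_sym : symmetric union_adj.
Proof. by move=> [a|a] [b|b] //=; rewrite adj_sym. Qed.
Fact union_adj_irrefl : irreflexive union_adj.
Proof. by move=> [a|a] /=; rewrite adj_irrefl. Qed.
Definition disjoint_union := SGraph union_adj_sym union_adj_irrefl.
End DisjointUnion.

Section Induced.
Variables (G : sgraph) (S : {set G}).
Let induced_adj (x y : {z : G | z \in S}) := adj (val x) (val y).
Fact induced_adj_sym : symmetric induced_adj.
Proof. by move=> x y; rewrite /induced_adj adj_sym. Qed.
Fact induced_adj_irrefl : irreflexive induced_adj.
Proof. by move=> x; rewrite /induced_adj adj_irrefl. Qed.
Definition induced := SGraph induced_adj_sym induced_adj_irrefl.
End Induced.

Definition edges (G : sgraph) : {set {set G}} :=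
  [set e : {set G} | [exists x : G, exists y : G, adj x y && (e == [set x; y])]].

(* The pair P is a (vertex set, edge set) pair. *)
Definition is_subgraph (G : sgraph) (P : {set G} * {set {set G}}) : bool :=
  (P.2 \subset edges G) && [forall e in P.2, e \subset P.1].

Section SubgraphGraph.
Variables (G : sgraph) (P : {set G} * {set {set G}}).
Let sub_adj (x y : {z : G | z \in P.1}) :=
  (x != y) && ([set val x; val y] \in P.2).
Fact sub_adj_sym : symmetric sub_adj.
Proof. by move=> x y; rewrite /sub_adj eq_sym setUC. Qed.
Fact sub_adj_irrefl : irreflexive sub_adj.
Proof. by move=> x; rewrite /sub_adj eqxx. Qed.
Definition subgraph_graph := SGraph sub_adj_sym sub_adj_irrefl.
End SubgraphGraph.

(* H(G) *)
Definition subgraph_count (H G : sgraph) : nat :=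
  #|[set P : {set G} * {set {set G}} |
      is_subgraph P && `[< sgraph_iso (subgraph_graph P) H >]]|.

(* k(H) *)
Definition num_components (H : sgraph) : nat := n_comp (@adj H) H.

Definition connected_graph (H : sgraph) : Prop :=
  (0 < #|H|)%N /\ forall x y : H, connect adj x y.

Definition no_isolated_vertex (H : sgraph) : Prop :=
  forall x : H, exists y : H, adj x y.

Section GraphPolynomial.
Variables (R : realType) (f : sgraph -> {poly R[i]}).

Definition monic_graphpoly : Prop :=
  forall G : sgraph, f G \is monic /\ size (f G) = #|G|.+1.

Definition iso_invariant : Prop :=
  forall G1 G2 : sgraph, sgraph_iso G1 G2 -> f G1 = f G2.

Definition multiplicative_graphpoly : Prop :=
  forall G1 G2 : sgraph, f (disjoint_union G1 G2) = f G1 * f G2.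

Definition exponential_type : Prop :=
  f empty_graph = 1 /\
  forall (G : sgraph) (x y : R[i]),
    \sum_(S : {set G}) (f (induced S)).[x] * (f (induced (~: S))).[y]
      = (f G).[x + y].

(* f(G,x) = \sum_(k <= n) (-1)^k e_k(G) x^(n-k), with n = |V(G)|; as usual for
   elementary symmetric functions, e_k(G) = 0 for k > n. *)
Definition root_esym (k : nat) (G : sgraph) : R[i] :=
  if (k <= #|G|)%N then (-1) ^+ k * (f G)`_(#|G| - k) else 0.

(* closed_field_poly_normal provides the list of roots with multiplicity. *)
Definition root_psum (k : nat) (G : sgraph) : R[i] :=
  \sum_(z <- sval (closed_field_poly_normal (f G))) z ^+ k.

End GraphPolynomial.

Definition subgraph_count_comb (R : realType) (Q : sgraph -> Prop)
    (phi : sgraph -> R[i]) : Prop :=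
  exists (m : nat) (c : 'I_m -> R[i]) (H : 'I_m -> sgraph),
    (forall i, Q (H i)) /\
    forall G : sgraph, phi G = \sum_(i < m) c i * (subgraph_count (H i) G)%:R.

(* Main.v *)
Require Import Defs.
From HB Require Import structures.
From mathcomp Require Import all_boot all_order all_algebra.
From mathcomp Require Import boolp reals complex.
From mathcomp Require Import ring zify.

(** For an isomorphism-invariant graph parameter phi and a fixed graph G,
    consider (S, E) |-> phi(S, E restricted to S) on pairs of a vertex set and an
    edge set.  Its Boolean Moebius transform is the coefficient with which the
    subgraph (S, E) contributes to phi(G), and it depends only on the isomorphism
    class of (S, E); hence phi is a combination of the functions H(.) with H
    ranging over the support of the transform.

    Let b be the coefficient of x in f.  The exponential identity gives, for the
    vertex transform eta_k of the coefficient of x^(n-k), the recursion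
      (|A| - k) eta_k(A)
        = \sum_(B \subset A, |B| >= 2) b(B) eta_(k + 1 - |B|)(A \ B),
    so, transforming the edges as well, the support of e_k is built by adding
    vertex-disjoint blocks B, each of which raises k by |B| - 1.  If f is
    multiplicative then the transform of b lives on connected graphs, and the
    blocks are the components.

    The power sums follow by Newton's identities, because sizes and graphic ranks
    are subadditive under unions of subgraphs.  If f is multiplicative then p_k is
    additive over disjoint unions, so its transform vanishes on disconnected
    graphs. *)

Set Implicit Arguments.
Unset Strict Implicit.
Unset Printing Implicit Defensive.

Import GRing.Theory Num.Theory.
Local Open Scope ring_scope.

(** * Boolean Moebius transforms *)

Section Mobius.
Variables (K : comNzRingType) (U : finType).
Implicit Types (F : {set U} -> K) (A B X : {set U}).

Definition mob F A : K := \sum_(B : {set U} | B \subset A) (-1) ^+ #|A :\: B| * F B.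

Lemma eq_mob F1 F2 A :
  (forall X, X \subset A -> F1 X = F2 X) -> mob F1 A = mob F2 A.
Proof. by move=> eqF; apply: eq_bigr => X /eqF ->. Qed.

Lemma mob_sum (I : finType) (P : pred I) (F : I -> {set U} -> K) A :
  mob (fun X => \sum_(i | P i) F i X) A = \sum_(i | P i) mob (F i) A.
Proof.
rewrite /mob exchange_big /=; apply: eq_bigr => X _.
by rewrite mulr_sumr.
Qed.

Lemma mobD F1 F2 A :
  mob (fun X => F1 X + F2 X) A = mob F1 A + mob F2 A.
Proof. by rewrite -big_split; apply: eq_bigr => X _; rewrite mulrDr. Qed.

Lemma mobZ (c : K) F A : mob (fun X => c * F X) A = c * mob F A.
Proof. by rewrite /mob mulr_sumr; apply: eq_bigr => X _; rewrite mulrCA. Qed.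

Lemma mob_eq0 F A : (forall X, X \subset A -> F X = 0) -> mob F A = 0.
Proof. by move=> F0; rewrite /mob big1 // => X /F0 ->; rewrite mulr0. Qed.

(** Pairing each X that avoids u with [u |: X] cancels the signed sum. Every vanishing statement
    about transforms below rests on this. *)
Lemma mob_indep F A u : u \in A ->
  (forall X, X \subset A -> F X = F (X :\ u)) -> mob F A = 0.
Proof.
move=> uA Fu; rewrite /mob (bigID (fun X => u \in X)) /= addrC.
rewrite [X in _ + X](reindex_onto (fun X => u |: X) (fun X => X :\ u)) /=; last first.
  by move=> X /andP[_ uX]; rewrite setD1K.
rewrite [X in _ + X](eq_bigl (fun X => (X \subset A) && (u \notin X))); last first.
  move=> X; rewrite subUset sub1set uA setU11 andbT /=.
  congr (_ && _); apply/eqP/idP => [<-|uX]; last by rewrite setU1K.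
  by rewrite setD11.
rewrite -big_split big1 //= => X /andP[XA uX].
rewrite [F (u |: X)]Fu ?subUset ?sub1set ?uA // setU1K //.
have uAX : u \in A :\: X by rewrite inE uX.
rewrite (cardsD1 u (A :\: X)) uAX add1n exprS setDDl setUC mulN1r mulNr.
by rewrite addrC subrr.
Qed.

(** Superset indicators form the basis in which [mob] reads off coefficients. If B is a proper
    subset of A, an element of A outside B does not affect the indicator, and [mob_indep]
    applies. *)
Lemma mob_up B A : mob (fun X => (B \subset X)%:R) A = (A == B)%:R.
Proof.
case: (boolP (B \subset A)) => [BA|nBA]; last first.
  rewrite mob_eq0 => [|X XA].
    by case: eqP => // AB; rewrite AB subxx in nBA.
  by case: (boolP (B \subset X)) => // BX; rewrite (subset_trans BX XA) in nBA.
case: eqVneq => [->|neAB].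
  rewrite /mob (bigD1 B) //= setDv cards0 expr0 mul1r subxx big1 ?addr0 // => X.
  case/andP=> XB neXB; case: (boolP (B \subset X)) => BX; rewrite ?mulr0 //.
  by rewrite eqEsubset XB BX in neXB.
have /properP[_ [u uA nuB]] : B \proper A.
  by rewrite properEneq eq_sym neAB BA.
apply: (mob_indep uA) => X _; congr (_%:R); congr nat_of_bool.
by rewrite subsetD1 nuB andbT.
Qed.

Lemma mob_unique F (c : {set U} -> K) :
  (forall X, F X = \sum_(B : {set U} | B \subset X) c B) -> forall A, mob F A = c A.
Proof.
move=> Fc A.
rewrite (@eq_mob _ (fun X => \sum_(B : {set U}) c B * (B \subset X)%:R)); last first.
  move=> X _; rewrite Fc big_mkcond /=; apply: eq_bigr => B _.
  by case: (B \subset X); rewrite ?mulr1 ?mulr0.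
rewrite mob_sum (bigD1 A) //= mobZ mob_up eqxx mulr1 big1 ?addr0 // => B neBA.
by rewrite mobZ mob_up eq_sym (negbTE neBA) mulr0.
Qed.

(** The system is triangular: the term B = A has coefficient 1, and the other terms involve proper
    subsets only. *)
Lemma mob_inj F1 F2 : (forall A, mob F1 A = mob F2 A) -> F1 =1 F2.
Proof.
move=> eqm A; have [n] := ubnP #|A|; elim: n A => // n IHn A leAn.
have := eqm A; rewrite /mob !(bigD1 (P := fun B => B \subset A) A) //=.
rewrite setDv cards0 expr0 !mul1r.
rewrite (eq_bigr (fun B : {set U} => (-1) ^+ #|A :\: B| * F2 B)); first exact: addIr.
move=> B /andP[BA neBA]; rewrite IHn //.
have /proper_card : B \proper A by rewrite properEneq neBA BA.
by move=> ltBA; apply: leq_trans ltBA _; rewrite -ltnS.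
Qed.

Lemma mob_inv F A : F A = \sum_(B : {set U} | B \subset A) mob F B.
Proof.
rewrite -[RHS]/((fun X => \sum_(B : {set U} | B \subset X) mob F B) A).
by apply: mob_inj => {}A; rewrite [RHS](@mob_unique _ (mob F)).
Qed.

(** The superset indicators of B and of C multiply to that of their union, so products turn into
    convolutions over unions. *)
Lemma mobM F1 F2 A : mob (fun X => F1 X * F2 X) A =
  \sum_(B : {set U}) \sum_(C : {set U} | B :|: C == A) mob F1 B * mob F2 C.
Proof.
apply: (mob_unique
  (c := fun A => \sum_B \sum_(C : {set U} | B :|: C == A) mob F1 B * mob F2 C)).
move=> X; rewrite exchange_big /= (mob_inv F1 X) big_distrl /= big_mkcond /=.
apply: eq_bigr => B _; case: ifP => BX; last first.
  rewrite big1 // => A' A'X; rewrite big1 // => C /eqP AE.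
  by move: A'X; rewrite -AE subUset BX.
rewrite (mob_inv F2 X) big_distrr /=.
rewrite (exchange_big_dep (fun C : {set U} => C \subset X)) /=; last first.
  by move=> A' C A'X /eqP AE; move: A'X; rewrite -AE subUset => /andP[].
apply: eq_bigr => C CX; rewrite (big_pred1 (B :|: C)) // => D.
rewrite andbC [_ == D]eq_sym /=; case: eqP => [->|//].
by rewrite subUset BX CX.
Qed.

Lemma mobM_neq0 F1 F2 A : mob (fun X => F1 X * F2 X) A != 0 ->
  exists B C, [/\ B :|: C = A, mob F1 B != 0 & mob F2 C != 0].
Proof.
move=> nz; apply: contrapT => noBC; case/eqP: nz; rewrite mobM.
rewrite big1 // => B _; rewrite big1 // => C /eqP BCA.
have [->|nzB] := eqVneq (mob F1 B) 0; first by rewrite mul0r.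
have [->|nzC] := eqVneq (mob F2 C) 0; first by rewrite mulr0.
by case: noBC; exists B, C.
Qed.

End Mobius.

Lemma imset_powerset (T T' : finType) (i : T -> T') (A : {set T}) :
  powerset (i @: A) = [set i @: (B : {set T}) | B in powerset A].
Proof.
apply/setP=> X; apply/idP/imsetP => [|[B]].
  rewrite powersetE => /subsetP sXA; exists (A :&: i @^-1: X).
    by rewrite powersetE subsetIl.
  apply/setP=> y; apply/idP/imsetP => [yX|[x]]; last by rewrite !inE => /andP[_ ?] ->.
  by have /imsetP[x xA yE] := sXA y yX; exists x; rewrite // !inE xA -yE.
by rewrite !powersetE => BA ->; apply: imsetS.
Qed.

Lemma mob_imset (K : comNzRingType) (T T' : finType) (i : T -> T')
    (F : {set T'} -> K) (A : {set T}) :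
  injective i -> mob F (i @: A) = mob (fun X => F (i @: X)) A.
Proof.
move=> inj_i; rewrite /mob.
rewrite [LHS](eq_bigl (fun B => B \in powerset (i @: A))); last first.
  by move=> B; rewrite powersetE.
rewrite imset_powerset big_imset /=; last by move=> B C _ _; apply: imset_inj.
apply: eq_big => [B|B]; rewrite powersetE // => BA.
by rewrite !cardsDS ?imsetS // !card_imset.
Qed.

(** * Transforms in two set variables, vertices and edges *)

Section Mobius2.
Variables (K : comNzRingType) (T U : finType).
Implicit Types (F : {set T} -> {set U} -> K) (A S : {set T}) (E X : {set U}).

Definition mob2 F A E : K := mob (fun S => mob (F S) E) A.

Lemma mob2C F A E : mob2 F A E = mob (fun X => mob (F^~ X) A) E.
Proof.
rewrite /mob2 /mob; under eq_bigr do rewrite mulr_sumr.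
rewrite exchange_big /=; apply: eq_bigr => X _; rewrite mulr_sumr.
by apply: eq_bigr => S _; rewrite mulrCA.
Qed.

Lemma eq_mob2 F1 F2 A E :
  (forall S X, S \subset A -> X \subset E -> F1 S X = F2 S X) ->
  mob2 F1 A E = mob2 F2 A E.
Proof. by move=> eqF; apply: eq_mob => S SA; apply: eq_mob => X; apply: eqF. Qed.

Lemma mob2_sum (I : finType) (P : pred I) (F : I -> {set T} -> {set U} -> K) A E :
  mob2 (fun S X => \sum_(i | P i) F i S X) A E = \sum_(i | P i) mob2 (F i) A E.
Proof. by rewrite /mob2 -mob_sum; apply: eq_mob => S _; rewrite mob_sum. Qed.

Lemma mob2D F1 F2 A E :
  mob2 (fun S X => F1 S X + F2 S X) A E = mob2 F1 A E + mob2 F2 A E.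
Proof. by rewrite /mob2 -mobD; apply: eq_mob => S _; rewrite mobD. Qed.

Lemma mob2Z (c : K) F A E : mob2 (fun S X => c * F S X) A E = c * mob2 F A E.
Proof. by rewrite /mob2 -mobZ; apply: eq_mob => S _; rewrite mobZ. Qed.

Lemma mob2_inv F A E :
  F A E = \sum_(B : {set T} | B \subset A) \sum_(X : {set U} | X \subset E) mob2 F B X.
Proof.
rewrite exchange_big [LHS](mob_inv (F A)); apply: eq_bigr => X _.
by rewrite [LHS](mob_inv (fun S => mob (F S) X)).
Qed.

Lemma mob2_indepl F A E u : u \in A ->
  (forall S X, S \subset A -> X \subset E -> F S X = F (S :\ u) X) -> mob2 F A E = 0.
Proof.
move=> uA Fu; apply: (mob_indep uA) => S SA; apply: eq_mob => X XE; exact: Fu.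
Qed.

Lemma mob2_indepr F A E e : e \in E ->
  (forall S X, S \subset A -> X \subset E -> F S X = F S (X :\ e)) -> mob2 F A E = 0.
Proof.
move=> eE Fe; apply: mob_eq0 => S SA; apply: (mob_indep eE) => X; exact: Fe.
Qed.

Lemma mob2M_neq0 F1 F2 A E : mob2 (fun S X => F1 S X * F2 S X) A E != 0 ->
  exists A1 A2 E1 E2, [/\ A1 :|: A2 = A, E1 :|: E2 = E,
    mob2 F1 A1 E1 != 0 & mob2 F2 A2 E2 != 0].
Proof.
move=> nz; apply: contrapT => no; case/eqP: nz; rewrite /mob2.
under eq_mob do rewrite mobM.
rewrite mob_sum big1 // => E1 _; rewrite mob_sum big1 // => E2 /eqP E12.
apply/eqP; apply: contraT => /mobM_neq0[A1 [A2 [A12 nz1 nz2]]].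
by case: no; exists A1, A2, E1, E2.
Qed.

End Mobius2.

(** * Graph isomorphisms *)

Lemma sgraph_iso_refl G : sgraph_iso G G.
Proof. by exists id => //; exists id. Qed.

Lemma sgraph_iso_sym G H : sgraph_iso G H -> sgraph_iso H G.
Proof.
case=> h [h' hK h'K] hadj; exists h'; first by exists h.
by move=> x y; rewrite -hadj !h'K.
Qed.

Lemma sgraph_iso_trans G H I : sgraph_iso G H -> sgraph_iso H I -> sgraph_iso G I.
Proof.
case=> h bij_h hadj [g bij_g gadj]; exists (g \o h); first exact: bij_comp.
by move=> x y; rewrite gadj hadj.
Qed.

Lemma sgraph_iso_card G H : sgraph_iso G H -> #|G| = #|H|.
Proof. by case=> h /bij_eq_card. Qed.

(** Reduces the isomorphisms below to embeddings into the ambient vertex set, away from the subtype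
    of vertices of [P]. *)
Lemma subgraph_graph_iso (H G : sgraph) (P : {set G} * {set {set G}}) (j : H -> G) :
  injective j -> (forall x, j x \in P.1) -> (forall z, z \in P.1 -> exists x, j x = z) ->
  (forall x y, adj x y = (x != y) && ([set j x; j y] \in P.2)) ->
  sgraph_iso H (subgraph_graph P).
Proof.
move=> inj_j jP Pj jadj.
pose h x : subgraph_graph P := exist _ (j x) (jP x).
exists h; last by move=> x y; rewrite jadj /= -val_eqE /= inj_eq.
apply: inj_card_bij => [x y /(congr1 val)/inj_j //|].
rewrite card_sig -(card_imset predT inj_j); apply: subset_leq_card.
by apply/subsetP=> z /Pj[x <-]; apply: imset_f.
Qed.

Lemma edgesP (G : sgraph) (x y : G) : ([set x; y] \in edges G) = adj x y.
Proof.
rewrite inE; apply/existsP/idP => [[a /existsP[b /andP[ab /eqP E]]]|xy]; last first.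
  by exists x; apply/existsP; exists y; rewrite xy eqxx.
have neab : a != b by apply: contraTneq ab => ->; rewrite adj_irrefl.
have: a \in [set x; y] by rewrite E set21.
have: b \in [set x; y] by rewrite E set22.
rewrite !inE; case/pred2P=> [bE|bE] /pred2P[aE|aE]; subst => //;
  by [rewrite eqxx in neab | rewrite adj_sym].
Qed.

Lemma edges_elim (G : sgraph) (e : {set G}) : e \in edges G ->
  exists x y, [/\ adj x y, x != y & e = [set x; y]].
Proof.
rewrite inE => /existsP[x /existsP[y /andP[xy /eqP ->]]]; exists x, y; split=> //.
by apply: contraTneq xy => ->; rewrite adj_irrefl.
Qed.

Lemma full_subgraph_iso (G : sgraph) :
  sgraph_iso G (subgraph_graph ([set: G], edges G)).
Proof.
apply: (@subgraph_graph_iso _ _ _ id) => // [z _|x y]; first by exists z.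
rewrite edgesP; case: eqVneq => [->|//]; exact: adj_irrefl.
Qed.

Definition sgval (G : sgraph) (P : {set G} * {set {set G}})
  (x : subgraph_graph P) : G := sval x.

Lemma sgval_inj (G : sgraph) (P : {set G} * {set {set G}}) : injective (@sgval G P).
Proof. exact: val_inj. Qed.

Lemma sgvalP (G : sgraph) (P : {set G} * {set {set G}}) (x : subgraph_graph P) :
  sgval x \in P.1.
Proof. by case: x. Qed.

Lemma sgval_surj (G : sgraph) (P : {set G} * {set {set G}}) (z : G) : z \in P.1 ->
  exists x : subgraph_graph P, sgval x = z.
Proof. by move=> zP; exists (exist _ z zP). Qed.

Lemma sgval_adj (G : sgraph) (P : {set G} * {set {set G}}) (x y : subgraph_graph P) :
  adj x y = (x != y) && ([set sgval x; sgval y] \in P.2).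
Proof. by []. Qed.

Lemma image_subgraph_iso (H G : sgraph) (i : H -> G) (A : {set H}) (E : {set {set H}}) :
  injective i ->
  sgraph_iso (subgraph_graph (A, E))
    (subgraph_graph (i @: A, [set i @: (e : {set H}) | e in E])).
Proof.
move=> inj_i.
apply: (@subgraph_graph_iso _ _ _ (fun x : subgraph_graph (A, E) => i (sgval x))).
- by move=> x y /inj_i/sgval_inj.
- by move=> x; apply/imset_f/(sgvalP x).
- by move=> z /imsetP[x /(@sgval_surj _ (A, E))[{}x <-] ->]; exists x.
move=> x y; rewrite sgval_adj; congr (_ && _).
have -> : [set i (sgval x); i (sgval y)] = i @: [set sgval x; sgval y].
  by rewrite imsetU1 imset_set1.
by rewrite mem_imset //; apply: imset_inj.
Qed.

Lemma eq_subgraph_iso (G : sgraph) (A : {set G}) (E E' : {set {set G}}) :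
  (forall x y, x \in A -> y \in A -> x != y -> ([set x; y] \in E) = ([set x; y] \in E')) ->
  sgraph_iso (subgraph_graph (A, E)) (subgraph_graph (A, E')).
Proof.
move=> EE'; apply: (@subgraph_graph_iso _ _ _ (@sgval G (A, E))).
- exact: sgval_inj.
- exact: sgvalP.
- exact: sgval_surj.
move=> x y; rewrite sgval_adj; case: eqVneq => //= nexy.
by apply: EE'; rewrite ?(inj_eq (@sgval_inj _ _)) ?(sgvalP x) ?(sgvalP y).
Qed.

Lemma induced_subgraph_iso (G : sgraph) (P : {set G} * {set {set G}})
    (B : {set subgraph_graph P}) :
  sgraph_iso (induced B) (subgraph_graph (@sgval G P @: B, P.2)).
Proof.
apply: (@subgraph_graph_iso _ _ _ (fun x : induced B => sgval (sval x))).
- by move=> x y /sgval_inj/val_inj.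
- by case=> x xB; apply: imset_f.
- by move=> z /imsetP[x xB ->]; exists (exist _ x xB).
by [].
Qed.

Lemma empty_subgraph_iso (G : sgraph) (E : {set {set G}}) :
  sgraph_iso empty_graph (subgraph_graph (set0, E)).
Proof.
apply: (@subgraph_graph_iso empty_graph _ _ (fun x : void => match x with end)).
- by case.
- by case.
- by move=> z; rewrite inE.
by case.
Qed.

Lemma union_subgraph_iso (G : sgraph) (A B : {set G}) (E : {set {set G}}) :
  [disjoint A & B] ->
  (forall x y, x \in A -> y \in B -> [set x; y] \notin E) ->
  sgraph_iso (disjoint_union (subgraph_graph (A, E)) (subgraph_graph (B, E)))
    (subgraph_graph (A :|: B, E)).
Proof.
move=> disAB cross.
have neAB (x : subgraph_graph (A, E)) (y : subgraph_graph (B, E)) : sgval x != sgval y.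
  apply/eqP=> xy; have := disjointFr disAB (sgvalP x).
  by rewrite xy (sgvalP y).
pose j (z : disjoint_union (subgraph_graph (A, E)) (subgraph_graph (B, E))) : G :=
  match z with inl x => sgval x | inr y => sgval y end.
apply: (@subgraph_graph_iso _ _ _ j).
- move=> [x|x] [y|y] /= xy; try by congr (_ _); apply: sgval_inj.
    by move: (neAB x y); rewrite xy eqxx.
  by move: (neAB y x); rewrite xy eqxx.
- by move=> [x|x]; rewrite inE (sgvalP x) ?orbT.
- move=> z /setUP[/(@sgval_surj _ (A, E))|/(@sgval_surj _ (B, E))] [x <-].
    by exists (inl x).
  by exists (inr x).
move=> [x|x] [y|y] //=.
  by rewrite (negbTE (cross _ _ (sgvalP x) (sgvalP y))).
by rewrite setUC (negbTE (cross _ _ (sgvalP y) (sgvalP x))).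
Qed.

(** * Subgraph counts and the transform of a graph parameter *)

Section GraphMobius.
Variables (K : comNzRingType) (phi : sgraph -> K).
Hypothesis phi_iso : forall G H, sgraph_iso G H -> phi G = phi H.

(** The coefficient with which the subgraph (A, E) contributes to [phi G]. *)
Definition gmob (G : sgraph) : {set G} -> {set {set G}} -> K :=
  mob2 (fun S X => phi (subgraph_graph (S, X))).

Lemma gmob_image (H G : sgraph) (i : H -> G) (A : {set H}) (E : {set {set H}}) :
  injective i ->
  gmob (i @: A) [set i @: (e : {set H}) | e in E] = gmob A E.
Proof.
move=> inj_i; rewrite /gmob /mob2 mob_imset //; apply: eq_mob => S _.
rewrite mob_imset; last exact: imset_inj.
by apply: eq_mob => X _; apply/esym/phi_iso/image_subgraph_iso.
Qed.

(** The isomorphism followed by the inclusion embeds H in G with image P, so the coefficient depends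
    on the isomorphism class only. *)
Lemma gmob_full (H G : sgraph) (P : {set G} * {set {set G}}) :
  is_subgraph P -> sgraph_iso H (subgraph_graph P) ->
  gmob P.1 P.2 = gmob [set: H] (edges H).
Proof.
move=> /andP[P2 /forall_inP P12] [h [h' hK h'K] hadj].
pose i x := sgval (h x).
have inj_i : injective i by move=> x y /sgval_inj/(can_inj hK).
rewrite -(gmob_image _ _ inj_i); congr gmob; apply/setP=> z.
  apply/idP/imsetP => [/sgval_surj[x <-]|[x _ ->]]; last exact: sgvalP.
  by exists (h' x); rewrite // /i h'K.
apply/idP/imsetP => [zP|[e /edges_elim[x [y [xy _ ->]]] ->]].
  have [a [b [_ neab zE]]] := edges_elim (subsetP P2 z zP).
  move: (P12 z zP); rewrite zE subUset !sub1set => /andP[].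
  move=> /sgval_surj[a' aE] /sgval_surj[b' bE].
  exists [set h' a'; h' b']; last by rewrite imsetU1 imset_set1 /i !h'K aE bE.
  rewrite edgesP -hadj !h'K sgval_adj aE bE -zE zP andbT.
  by apply: contraNneq neab => E; rewrite -aE -bE E.
move: xy; rewrite -hadj sgval_adj => /andP[_].
by rewrite imsetU1 imset_set1.
Qed.

(** A member of E not contained in A is invisible to every (S, X) with S inside A, so the edge
    transform vanishes. *)
Lemma gmob_subgraph (G : sgraph) (A : {set G}) (E : {set {set G}}) :
  gmob A E != 0 -> {in E, forall e : {set G}, e \subset A}.
Proof.
move=> nz e eE; apply: contraNT nz => nsub; apply/eqP.
apply: (mob2_indepr eE) => S X SA _; apply/phi_iso/eq_subgraph_iso => x y xS yS _.
rewrite in_setD1; case: eqP => // xyE; case/negP: nsub; rewrite -xyE.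
by rewrite subUset !sub1set !(subsetP SA).
Qed.

Lemma phi_gmob (G : sgraph) :
  phi G = \sum_(P : {set G} * {set {set G}} | is_subgraph P) gmob P.1 P.2.
Proof.
rewrite (phi_iso (full_subgraph_iso G)).
rewrite (mob2_inv (fun S X => phi (subgraph_graph (S, X)))) pair_big /=.
rewrite big_mkcond [RHS]big_mkcond /=; apply: eq_bigr => P _.
rewrite subsetT /= /is_subgraph; case: ifP => //= _; case: ifP => // nsub.
apply/eqP; apply: contraFT nsub => nz.
by apply/forall_inP=> e eP; apply: gmob_subgraph eP.
Qed.

End GraphMobius.

(** * Finitely many representatives of the isomorphism classes *)

Section Complete.
Variable n : nat.
Let complete_adj (x y : 'I_n) := x != y.
Fact complete_adj_sym : symmetric complete_adj.
Proof. by move=> x y; rewrite /complete_adj eq_sym. Qed.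
Fact complete_adj_irrefl : irreflexive complete_adj.
Proof. by move=> x; rewrite /complete_adj eqxx. Qed.
Definition complete := SGraph complete_adj_sym complete_adj_irrefl.
End Complete.

Lemma iso_complete (G : sgraph) : exists E : {set {set complete #|G|}},
  is_subgraph ([set: complete #|G|], E)
  /\ sgraph_iso G (subgraph_graph ([set: complete #|G|], E)).
Proof.
pose i : G -> complete #|G| := @enum_rank G.
have inj_i : injective i by exact: enum_rank_inj.
exists [set i @: (e : {set G}) | e in edges G]; split.
  apply/andP; split; last by apply/forall_inP=> e _; apply: subsetT.
  apply/subsetP=> z /imsetP[e /edges_elim[x [y [_ nexy ->]]] ->].
  by rewrite imsetU1 imset_set1 edgesP /= inj_eq.
apply: sgraph_iso_trans (full_subgraph_iso G) _.
have := image_subgraph_iso [set: G] (edges G) inj_i.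
suff -> : i @: [set: G] = [set: complete #|G|] by [].
by apply/setP=> z; rewrite inE; apply/imsetP; exists (enum_val z); rewrite // /i enum_valK.
Qed.

(** Groups the terms of [phi_gmob] by isomorphism class. The bound N leaves finitely many classes,
    represented by spanning subgraphs of complete graphs on at most N vertices. *)
Lemma comb_of_support (R : realType) (phi : sgraph -> R[i]) (Q : sgraph -> Prop) N :
  (forall G H, sgraph_iso G H -> phi G = phi H) ->
  (forall (G : sgraph) (P : {set G} * {set {set G}}), is_subgraph P ->
     gmob phi P.1 P.2 != 0 -> Q (subgraph_graph P) /\ (#|P.1| <= N)%N) ->
  subgraph_count_comb Q phi.
Proof.
move=> phi_iso supp.
pose I : finType := {n : 'I_N.+1 & {set {set complete n}}}.
pose pr (i : I) : {set complete (tag i)} * {set {set complete (tag i)}} :=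
  (setT, tagged i).
pose gr i := subgraph_graph (pr i).
pose w i := gmob phi (pr i).1 (pr i).2.
pose A := [pred i | is_subgraph (pr i) && (w i != 0)].
pose cl (H : sgraph) := #|[pred i | A i & `[< sgraph_iso H (gr i) >]]|.
(* The complete graph on n vertices has several subgraphs isomorphic to a given
   one, so each of them receives an equal share of the weight of its class. *)
exists #|A|, (fun j => w (enum_val j) / (cl (gr (enum_val j)))%:R),
  (fun j => gr (enum_val j)).
split=> [j|G].
  have := enum_valP j; rewrite inE => /andP[sub nz].
  by have [] := supp _ _ sub nz.
rewrite -(big_enum_val (fun i => w i / (cl (gr i))%:R * (subgraph_count (gr i) G)%:R)).
have countE i : w i / (cl (gr i))%:R * (subgraph_count (gr i) G)%:R
   = \sum_(P : {set G} * {set {set G}} |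
       is_subgraph P && `[< sgraph_iso (subgraph_graph P) (gr i) >]) w i / (cl (gr i))%:R.
  rewrite sumr_const mulr_natr; congr (_ *+ _).
  by apply: eq_card => P; rewrite !inE.
under eq_bigr do rewrite countE.
(* It remains to see, for each fixed P, that the shares of the indices isomorphic to P add up to the
   coefficient of P. *)
rewrite (exchange_big_dep (@is_subgraph G)) /=; last by move=> i P _ /andP[].
rewrite phi_gmob //; apply: eq_bigr => P subP.
have wE i : A i && `[< sgraph_iso (subgraph_graph P) (gr i) >] ->
    w i / (cl (gr i))%:R = gmob phi P.1 P.2 / (cl (subgraph_graph P))%:R.
  case/andP=> /andP[subi _] /asboolP iso; congr (_ / _%:R).
    rewrite /w (gmob_full phi_iso subi iso).
    by rewrite -(gmob_full phi_iso subP (sgraph_iso_refl _)).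
  apply: eq_card => j; rewrite !inE; congr (_ && _); apply/asboolP/asboolP.
    exact: sgraph_iso_trans.
  exact/sgraph_iso_trans/sgraph_iso_sym.
rewrite (eq_bigl (fun i => A i && `[< sgraph_iso (subgraph_graph P) (gr i) >])); last first.
  by move=> i; rewrite subP.
rewrite (eq_bigr _ wE) sumr_const -[RHS]mulr_natr.
have [->|nz] := eqVneq (gmob phi P.1 P.2) 0; first by rewrite !mul0r.
(* A nonzero coefficient forces P to have at most N vertices, so a copy of P is among the indices
   and its class is nonempty. *)
suff cl0 : (cl (subgraph_graph P))%:R != 0 :> R[i] by rewrite divfK.
have [_ leN] := supp _ _ subP nz.
have [E [subE iso]] := iso_complete (subgraph_graph P).
have ltN : (#|subgraph_graph P| < N.+1)%N by rewrite ltnS card_sig.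
rewrite pnatr_eq0 -lt0n; apply/card_gt0P.
exists (Tagged (fun n : 'I_N.+1 => {set {set complete n}}) (i := Ordinal ltN) E).
rewrite !inE /= subE /=; apply/andP; split; last exact/asboolP.
rewrite /w (gmob_full phi_iso subE iso).
by rewrite -(gmob_full phi_iso subP (sgraph_iso_refl _)).
Qed.

(** * Graphic rank and connected components *)

Section Labelling.
Variable T : finType.
Implicit Types (g : T -> T) (E : {set {set T}}) (A D : {set T}).

(** Labellings constant on every edge stand in for paths: connectivity and rank are tested against
    all of them, which behaves well under unions of edge sets. *)
Definition const_on g E : Prop :=
  {in E, forall e : {set T}, {in e &, forall x y, g x = g y}}.

(* The graphic rank of E is at most k: k pairs generate an equivalence relation
   that contains every edge of E. *)
Definition rank_le k E : Prop :=
  exists2 s : seq (T * T), (size s <= k)%N &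
    forall g, {in s, forall p, g p.1 = g p.2} -> const_on g E.

(** D meets the E-component of every vertex of A; this bounds the number of components by the size
    of D. *)
Definition reaches E D A : Prop :=
  forall g, const_on g E -> forall x, x \in A -> exists2 d, d \in D & g x = g d.

Definition connected_on E A : Prop :=
  forall g, const_on g E -> {in A &, forall x y, g x = g y}.

Lemma const_onU g E1 E2 : const_on g E1 -> const_on g E2 -> const_on g (E1 :|: E2).
Proof. by move=> c1 c2 e /setUP[/c1|/c2]. Qed.

Lemma const_onS g E1 E2 : E1 \subset E2 -> const_on g E2 -> const_on g E1.
Proof. by move=> /subsetP s12 c2 e /s12/c2. Qed.

Lemma rank_le0 : rank_le 0 set0.
Proof. by exists [::] => // g _ e; rewrite inE. Qed.

Lemma rank_leU k1 k2 E1 E2 :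
  rank_le k1 E1 -> rank_le k2 E2 -> rank_le (k1 + k2) (E1 :|: E2).
Proof.
move=> [s1 le1 c1] [s2 le2 c2]; exists (s1 ++ s2); first by rewrite size_cat leq_add.
move=> g gs; apply: const_onU; [apply: c1 | apply: c2] => p ps; apply: gs;
  by rewrite mem_cat ps ?orbT.
Qed.

(** The star of pairs joining v to the other vertices of A already identifies all of A. *)
Lemma rank_le_block E A v : v \in A ->
  {in E, forall e : {set T}, e \subset A} -> rank_le #|A|.-1 E.
Proof.
move=> vA EA; exists [seq (v, x) | x <- enum (A :\ v)].
  by rewrite size_map -cardE (cardsD1 v A) vA.
move=> g gv; suff gA x : x \in A -> g x = g v.
  by move=> e eE x y xe ye; rewrite !gA ?(subsetP (EA e eE)).
have [->//|nexv xA] := eqVneq x v.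
have /gv <- // : (v, x) \in [seq (v, x) | x <- enum (A :\ v)].
by apply: map_f; rewrite mem_enum in_setD1 nexv.
Qed.

(** Starting from the identity, each pair merges two labels and so loses at most one. *)
Lemma labelling_of_pairs (s : seq (T * T)) : exists g,
  {in s, forall p, g p.1 = g p.2} /\ forall A, (#|A| <= #|g @: A| + size s)%N.
Proof.
elim: s => [|[a b] s [g [gs gA]]]; first by exists id; split=> // A; rewrite imset_id addn0.
exists (fun z => if g z == g a then g b else g z); split.
  move=> p; rewrite inE => /predU1P[->|/gs -> //] /=.
  by rewrite eqxx; case: (g b == g a).
move=> A; apply: leq_trans (gA A) _; rewrite /= addnS -addSn leq_add2r.
rewrite (cardsD1 (g a)) -add1n; apply: leq_add; first by case: (_ \in _).
apply/subset_leq_card/subsetP=> z; rewrite !inE => /andP[neza /imsetP[x xA zE]].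
by apply/imsetP; exists x; rewrite // -zE (negbTE neza).
Qed.

(** If no edge contained x, the labelling that separates x from everything else would be constant on
    edges. *)
Lemma connected_on_no_isolated E A x y : connected_on E A ->
  x \in A -> y \in A -> x != y -> exists2 e : {set T}, e \in E & x \in e.
Proof.
move=> conn xA yA nexy; apply: contrapT => iso.
pose g z := if z == x then x else y.
suff /conn/(_ x y xA yA) : const_on g E.
  by rewrite /g eqxx eq_sym (negbTE nexy) => /eqP; rewrite (negbTE nexy).
move=> e eE a b ae be.
have gE z : z \in e -> g z = y.
  by rewrite /g; case: eqP => // -> xe; case: iso; exists e.
by rewrite !gE.
Qed.

End Labelling.

Lemma adj_connect_sym (G : sgraph) : connect_sym (@adj G).
Proof. exact/sym_connect_sym/adj_sym. Qed.

Section Components.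
Variables (G : sgraph) (P : {set G} * {set {set G}}).
Local Notation SG := (subgraph_graph P).

(** A labelling that merges at most k labels is constant on components, so it takes at least |V| - k
    values and at most one per component. *)
Lemma num_components_ge k : rank_le k P.2 -> (#|SG| - num_components SG <= k)%N.
Proof.
case=> s sk sP; have [g [gs gA]] := labelling_of_pairs s.
have gc x y : connect (@adj SG) x y -> g (sgval x) = g (sgval y).
  case/connectP=> p + ->; elim: p x => //= z p IHp x /andP[/andP[_ xzP] /IHp <-].
  by apply: (sP g gs _ xzP); rewrite !inE eqxx ?orbT.
have cardSG : #|SG| = #|P.1| by rewrite card_sig.
rewrite leq_subLR cardSG.
apply: leq_trans (gA P.1) _; apply: leq_add sk.
apply: leq_trans (_ : _ <= #|(fun x => g (@sgval _ P x)) @: [set x in roots adj]|)%N _.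
  apply/subset_leq_card/subsetP=> z /imsetP[x /sgval_surj[{}x <-] ->].
  apply/imsetP; exists (fingraph.root adj x); last exact/gc/connect_root.
  by rewrite in_set; apply: (roots_root (@adj_connect_sym _)).
apply: leq_trans (leq_imset_card _ _) _; apply: eq_leq.
by apply: eq_card => x; rewrite !inE andbT.
Qed.

Hypothesis subP : is_subgraph P.

(** The canonical labelling by component representatives, extended by the identity outside [P.1] to
    be total on G. *)
Definition root_label (z : G) : G :=
  if insub z is Some x then sgval (fingraph.root adj (x : SG)) else z.

Lemma root_labelE (x : SG) : root_label (sgval x) = sgval (fingraph.root adj x).
Proof. by rewrite /root_label (valK (x : {z | z \in P.1})). Qed.

Lemma root_label_const : const_on root_label P.2.
Proof.
move=> e eP x y xe ye; have [->//|nexy] := eqVneq x y.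
have /andP[/subsetP/(_ e eP)/edges_elim[a [b [_ _ eE]]] /forall_inP/(_ e eP)/subsetP eS] := subP.
have {}eE : e = [set x; y].
  move: xe ye nexy; rewrite eE !inE => /pred2P[->|->] /pred2P[->|->];
    by rewrite ?eqxx // setUC.
have [x' xE] := sgval_surj (eS x xe); have [y' yE] := sgval_surj (eS y ye).
rewrite -xE -yE !root_labelE; congr sgval.
apply/(fingraph.rootP (@adj_connect_sym _))/connect1.
by rewrite sgval_adj xE yE -eE eP andbT; apply: contraNneq nexy => E; rewrite -xE -yE E.
Qed.

Lemma num_components_le D : reaches P.2 D P.1 -> (num_components SG <= #|D|)%N.
Proof.
move=> /(_ _ root_label_const) reach.
apply: leq_trans (leq_imset_card root_label D).
rewrite /num_components /n_comp_mem -(card_imset _ (@sgval_inj G P)).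
apply/subset_leq_card/subsetP=> z /imsetP[x]; rewrite !inE andbT => /eqP xr ->.
have [d dD E] := reach _ (sgvalP x); apply/imsetP; exists d => //.
by rewrite -E root_labelE xr.
Qed.

Lemma connected_on_graph : P.1 != set0 -> connected_on P.2 P.1 -> connected_graph SG.
Proof.
case/set0Pn=> z zP conn; split; first by rewrite card_sig; apply/card_gt0P; exists z.
move=> x y; apply/(fingraph.rootP (@adj_connect_sym _))/sgval_inj.
by rewrite -!root_labelE; apply: conn root_label_const _ _ (sgvalP x) (sgvalP y).
Qed.

End Components.

(** * Graph polynomials of exponential type *)

Lemma poly_horner_inj (K : numFieldType) (p q : {poly K}) :
  (forall x, p.[x] = q.[x]) -> p = q.
Proof.
move=> pq; apply/eqP; rewrite -subr_eq0; apply/eqP.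
pose s : seq K := [seq i%:R | i <- iota 0 (size (p - q))].
apply: (@roots_geq_poly_eq0 _ _ s).
- by apply/allP=> x _; rewrite /root !hornerE pq subrr.
- rewrite map_inj_uniq ?iota_uniq // => i j /eqP.
  by rewrite eqr_nat => /eqP.
by rewrite size_map size_iota.
Qed.

Section ExponentialType.
Variables (R : realType) (f : sgraph -> {poly R[i]}).
Hypotheses (f_iso : iso_invariant f) (f_monic : monic_graphpoly f).
Hypothesis f_exp : exponential_type f.

(* Up to the sign (-1)^k, this is e_k(H). *)
Definition eps k (H : sgraph) : R[i] :=
  if (k <= #|H|)%N then (f H)`_(#|H| - k) else 0.

Lemma eps_iso k G H : sgraph_iso G H -> eps k G = eps k H.
Proof. by move=> iso; rewrite /eps (sgraph_iso_card iso) (f_iso iso). Qed.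

Lemma eps0 H : eps 0 H = 1.
Proof.
rewrite /eps leq0n subn0; have [/monicP <- sz] := f_monic H.
by rewrite lead_coefE sz.
Qed.

Section FixedGround.
Variable G : sgraph.
Implicit Types (S A B : {set G}) (E X : {set {set G}}).

(** Edges leaving S are ignored, so the subgraph of (S, E) induced on B is (B, E) with the same
    E. *)
Let fS S E := f (subgraph_graph (S, E)).

Lemma card_subgraph S E : #|subgraph_graph (S, E)| = #|S|.
Proof. by rewrite card_sig. Qed.

Lemma size_fS S E : size (fS S E) = #|S|.+1.
Proof. by have [_ ->] := f_monic (subgraph_graph (S, E)); rewrite card_subgraph. Qed.

Lemma exp_subgraph S E x y :
  \sum_(B : {set G} | B \subset S) (fS B E).[x] * (fS (S :\: B) E).[y] = (fS S E).[x + y].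
Proof.
rewrite -(f_exp.2 (subgraph_graph (S, E)) x y).
pose v := @sgval G (S, E).
have vT : v @: [set: subgraph_graph (S, E)] = S.
  apply/setP=> z; apply/imsetP/idP => [[t _ ->]|/(@sgval_surj _ (S, E))[t <-]].
    exact: sgvalP.
  by exists t.
rewrite [LHS](eq_bigl (fun B => B \in powerset (v @: [set: subgraph_graph (S, E)]))); last first.
  by move=> B; rewrite powersetE vT.
rewrite imset_powerset big_imset; last first.
  by move=> B C _ _; apply: imset_inj; apply: sgval_inj.
apply: eq_big => [B|B _]; first by rewrite powersetE subsetT.
congr (_.[_] * _.[_]); apply/esym/f_iso.
  exact: (induced_subgraph_iso B).
suff -> : S :\: v @: B = v @: (~: B) by exact: (induced_subgraph_iso (~: B)).
rewrite -{1}vT; apply/setP=> z; rewrite inE.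
apply/andP/imsetP => [[nzB /imsetP[t _ zE]]|[t]].
  by exists t => //; rewrite inE; apply: contra nzB => tB; rewrite zE imset_f.
by rewrite inE => ntB ->; rewrite mem_imset ?imset_f //; apply: sgval_inj.
Qed.

Lemma exp_nderivn S E i x :
  \sum_(B : {set G} | B \subset S) (fS B E).[x] * (fS (S :\: B) E)`_i
    = ((fS S E)^`N(i)).[x].
Proof.
pose p := \sum_(B : {set G} | B \subset S) (fS B E).[x] *: fS (S :\: B) E.
(* The Taylor expansion in y; the length exceeds i so that the coefficient at i is never cut off. *)
pose q := \poly_(j < maxn i.+1 (size (fS S E))) (fS S E)^`N(j).[x].
have /(congr1 (fun r : {poly R[i]} => r`_i)) : p = q.
  apply: poly_horner_inj => y; rewrite horner_poly.
  rewrite -(nderiv_taylor_wide (mulrC x y)) ?leq_maxr // -exp_subgraph horner_sum.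
  by apply: eq_bigr => B _; rewrite hornerZ.
rewrite coef_poly leq_maxl => <-; rewrite coef_sum.
by apply: eq_bigr => B _; rewrite coefZ.
Qed.

(** The coefficient of x^j y^i in the exponential identity. *)
Lemma exp_coef S E i j :
  \sum_(B : {set G} | B \subset S) (fS B E)`_j * (fS (S :\: B) E)`_i
    = (fS S E)`_(i + j) *+ 'C(i + j, i).
Proof.
rewrite -coef_nderivn.
have <- : \sum_(B : {set G} | B \subset S) (fS (S :\: B) E)`_i *: fS B E = (fS S E)^`N(i).
  apply: poly_horner_inj => x; rewrite -exp_nderivn horner_sum.
  by apply: eq_bigr => B _; rewrite hornerZ mulrC.
by rewrite coef_sum; apply: eq_bigr => B _; rewrite coefZ mulrC.
Qed.

Lemma fS0 E : fS set0 E = 1.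
Proof. by rewrite -f_exp.1; apply/esym/f_iso/empty_subgraph_iso. Qed.

(** By induction only the terms B = S and B = [set0] survive in the identity for constant terms, so
    twice the constant term equals itself. *)
Lemma coef0_fS S E : S != set0 -> (fS S E)`_0 = 0.
Proof.
have [n] := ubnP #|S|; elim: n S => // n IHn S leSn S0.
have := exp_coef S E 0 0; rewrite addn0 bin0 mulr1n.
rewrite (bigD1 S) //= setDv fS0 coef1 mulr1 (bigD1 set0) /=; last first.
  by rewrite sub0set eq_sym.
rewrite setD0 fS0 coef1 mul1r big1 ?addr0.
  by move/eqP; rewrite -subr_eq0 addrK => /eqP.
move=> B /andP[/andP[BS neBS] B0]; rewrite IHn ?mul0r //.
have /proper_card ltBS : B \proper S by rewrite properEneq neBS BS.
by apply: leq_trans ltBS _; rewrite -ltnS.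
Qed.

Let b B E := (fS B E)`_1.

Lemma b0 E : b set0 E = 0.
Proof. by rewrite /b fS0 coef1. Qed.

Lemma b1 v E : b [set v] E = 1.
Proof.
have [/monicP <- _] := f_monic (subgraph_graph ([set v], E)).
by rewrite lead_coefE -/(fS _ _) size_fS cards1.
Qed.

Let epsS k S E := eps k (subgraph_graph (S, E)).

Lemma epsSE k S E : epsS k S E = if (k <= #|S|)%N then (fS S E)`_(#|S| - k) else 0.
Proof. by rewrite /epsS /eps card_subgraph. Qed.

(** The guard matters: for n > k + 1 the truncated difference is 0, and [epsS 0] is 1 instead of
    0. *)
Let epsS' k n S E := if (n <= k.+1)%N then epsS (k.+1 - n) S E else 0.

(** This is [exp_coef] with j = 1 and i = |S| - k - 1, whose binomial is |S| - k. For |S| at most k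
    both sides vanish. *)
Lemma eps_recur k S E :
  (#|S|%:R - k%:R) * epsS k S E =
  \sum_(B : {set G} | B \subset S) b B E * epsS' k #|B| (S :\: B) E.
Proof.
have [leSk|ltkS] := leqP #|S| k.
  rewrite big1 => [|B BS]; last first.
    rewrite /epsS' epsSE cardsDS //; have := subset_leq_card BS => leBS.
    case: (leqP #|B| k.+1) => leBk; rewrite ?mulr0 // ifF ?mulr0 //.
    by apply/negbTE; rewrite -ltnNge; lia.
  rewrite epsSE; case: leqP => [leks|]; last by rewrite mulr0.
  by rewrite (_ : k = #|S|) ?subrr ?mul0r //; lia.
rewrite epsSE ltnW //; have := exp_coef S E (#|S| - k.+1) 1.
rewrite addn1 -subSn // subSS => expE.
have -> : (#|S|%:R - k%:R) * (fS S E)`_(#|S| - k)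
    = (fS S E)`_(#|S| - k) *+ 'C(#|S| - k, #|S| - k.+1).
  have -> : (#|S| - k = (#|S| - k.+1).+1)%N by lia.
  rewrite binSn -[RHS]mulr_natl; congr (_ * _).
  by rewrite -natrB; [congr (_%:R); lia | exact: ltnW].
rewrite -expE; apply: eq_bigr => B BS; congr (_ * _).
have := subset_leq_card BS => leBS.
rewrite /epsS' epsSE cardsDS //; case: leqP => [leBk|ltkB]; last first.
  by rewrite nth_default // size_fS cardsDS //; lia.
by rewrite ifT; [congr (_`_ _); lia | lia].
Qed.

Let eta k A E := mob (fun S => epsS k S E) A.
Let eta' k n A E := if (n <= k.+1)%N then eta (k.+1 - n) A E else 0.

Lemma epsS'_eta' k n S E :
  epsS' k n S E = \sum_(A : {set G} | A \subset S) eta' k n A E.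
Proof.
rewrite /epsS' /eta'; case: ifP => _; last by rewrite big1.
exact: (mob_inv (fun S => epsS _ S E)).
Qed.

Lemma sum_small_sets (K : nmodType) (F : {set G} -> K) S :
  \sum_(B : {set G} | (B \subset S) && ~~ (1 < #|B|)%N) F B
    = F set0 + \sum_(v in S) F [set v].
Proof.
rewrite (bigD1 set0) ?sub0set ?cards0 //=; congr (_ + _).
rewrite -(big_imset F (h := set1) (A := mem S)) /=; last by move=> x y _ _; apply: set1_inj.
apply: eq_bigl => B; apply/andP/imsetP => [[/andP[BS]]|[v vS ->]].
  rewrite -leqNgt -cards_eq0 => le1 ne0.
  have /cards1P[v BE] : #|B| == 1%N by lia.
  by exists v; rewrite // -sub1set -BE.
by rewrite sub1set vS cards1 -cards_eq0 cards1.
Qed.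

(** In [eps_recur] the singletons B contribute the sum of [epsS k (S :\ v) E]. Expanded over subsets
    A', this counts [eta k A' E] once for each v in S outside A', which turns the factor |S| - k
    into |A'| - k. Uniqueness of the transform then gives the recursion. *)
Lemma eta_recur k A E :
  (#|A|%:R - k%:R) * eta k A E =
  \sum_(B : {set G} | (B \subset A) && (1 < #|B|)%N) b B E * eta' k #|B| (A :\: B) E.
Proof.
pose D S := \sum_(B : {set G} | (B \subset S) && (1 < #|B|)%N)
  b B E * epsS' k #|B| (S :\: B) E.
pose c1 A := (#|A|%:R - k%:R) * eta k A E.
pose c2 A := \sum_(B : {set G} | (B \subset A) && (1 < #|B|)%N)
  b B E * eta' k #|B| (A :\: B) E.
rewrite -/(c1 A) -/(c2 A).
rewrite -(@mob_unique _ _ D c1) -1?(@mob_unique _ _ D c2) // => S.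
  rewrite /D (exchange_big_dep (fun B => (B \subset S) && (1 < #|B|)%N)) /=; last first.
    by move=> A' B A'S /andP[BA' ->]; rewrite (subset_trans BA' A'S).
  apply: eq_bigr => B /andP[BS ltB].
  (* Subsets of [S :\: B] correspond to sets between B and S. *)
  rewrite epsS'_eta' mulr_sumr (reindex_onto (fun A => A :\: B) (fun A => A :|: B)) /=.
    apply: eq_bigl => A'; rewrite ltB andbT.
    have -> : A' :\: B :|: B = A' :|: B.
      by apply/setP=> z; rewrite !inE; case: (z \in B); rewrite ?orbT ?orbF.
    rewrite subDset -{1}(setIidPr BS) setID; congr (_ && _).
    by apply/eqP/idP => [<-|/setUidPl //]; rewrite subsetUr.
  move=> A'; rewrite subsetD => /andP[_ disAB].
  rewrite setDUl setDv setU0; exact/setDidPl.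
have eps_eta A' : epsS k A' E = \sum_(A'' : {set G} | A'' \subset A') eta k A'' E.
  exact: (mob_inv (fun S => epsS _ S E)).
have := eps_recur k S E.
rewrite (bigID (fun B : {set G} => 1 < #|B|)%N) /= -/(D S) sum_small_sets b0 mul0r add0r.
rewrite (eq_bigr (fun v => epsS k (S :\ v) E)); last first.
  by move=> v vS; rewrite b1 mul1r cards1 /epsS' /= subSS subn0.
rewrite eps_eta (eq_bigr _ (fun v _ => eps_eta (S :\ v))).
rewrite [X in _ = _ + X](exchange_big_dep (fun A' : {set G} => A' \subset S)) /=; last first.
  by move=> v A' vS; rewrite subsetD1 => /andP[].
move/(canLR (addrK _)) => <-.
rewrite mulr_sumr -sumrB; apply: eq_bigr => A' A'S.
rewrite (eq_bigl (fun v => v \in S :\: A')); last first.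
  by move=> v; rewrite subsetD1 A'S inE andbC.
rewrite sumr_const -[X in _ - X]mulr_natl cardsDS // natrB ?subset_leq_card // /c1.
by ring.
Qed.

(* Only the edges are transformed, the vertex set B being fixed. *)
Definition bmob B E : R[i] := mob (fun X => (f (subgraph_graph (B, X)))`_1) E.

Lemma bmob_subgraph B E : bmob B E != 0 -> {in E, forall e : {set G}, e \subset B}.
Proof.
move=> nz e eE; apply: contraNT nz => nsub; apply/eqP.
apply: (mob_indep eE) => X _.
suff /f_iso -> : sgraph_iso (subgraph_graph (B, X)) (subgraph_graph (B, X :\ e)) by [].
apply: eq_subgraph_iso => x y xB yB _.
rewrite in_setD1; case: eqP => // xyE; case/negP: nsub; rewrite -xyE.
by rewrite subUset !sub1set xB yB.
Qed.

(** * Support of the transform of the coefficients *)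

Lemma gmob_eps_small k A E : (0 < k)%N -> (#|A| <= k)%N -> gmob (eps k) A E = 0.
Proof.
move=> k0 leAk; apply: mob_eq0 => S /subset_leq_card leSA; apply: mob_eq0 => X _.
rewrite -/(epsS k S X) epsSE; case: leqP => // lekS.
have -> : (#|S| - k = 0)%N by lia.
by apply: coef0_fS; rewrite -cards_eq0; lia.
Qed.

Lemma gmob_eps0 A E : gmob (eps 0) A E != 0 -> A = set0 /\ E = set0.
Proof.
move=> nz; split; apply/eqP; apply: contraNT nz => /set0Pn[u uA]; apply/eqP.
  by apply: (mob2_indepl uA) => S X _ _; rewrite !eps0.
by apply: (mob2_indepr uA) => S X _ _; rewrite !eps0.
Qed.

(** Transforming [eta_recur] in the edges as well turns each product into a union E1, E2; the factor
    |A| - k is nonzero here. *)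
Lemma gmob_eps_step k A E : (k < #|A|)%N -> gmob (eps k) A E != 0 ->
  exists B E1 E2, [/\ B \subset A, (1 < #|B| <= k.+1)%N, E1 :|: E2 = E, bmob B E1 != 0
    & gmob (eps (k.+1 - #|B|)) (A :\: B) E2 != 0].
Proof.
move=> ltkA nz; have nzA : #|A|%:R - k%:R != 0 :> R[i].
  by rewrite subr_eq0 eqr_nat; lia.
have : (#|A|%:R - k%:R) * gmob (eps k) A E != 0 by rewrite mulf_neq0.
rewrite /gmob mob2C -mobZ.
rewrite (@eq_mob _ _ _ _ _ (fun X _ => eta_recur k A X)) mob_sum => {}nz.
apply: contrapT => no; case/eqP: nz; rewrite big1 // => B /andP[BA ltB].
have [leBk|ltkB] := leqP #|B| k.+1; last first.
  by rewrite mob_eq0 // => X _; rewrite /eta' leqNgt ltkB mulr0.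
apply/eqP; apply: contraT => /mobM_neq0[E1 [E2 [E12 nz1 nz2]]].
case: no; exists B, E1, E2; split=> //; first by rewrite ltB.
by move: nz2; rewrite /gmob mob2C /eta' leBk.
Qed.

(** Every pair in the support is assembled from the empty one by adding disjoint blocks B, each
    raising k by |B| - 1. *)
Lemma gmob_eps_ind (Pr : nat -> {set G} -> {set {set G}} -> Prop) :
  Pr 0 set0 set0 ->
  (forall k j A B E1 E2, B \subset A -> (1 < #|B|)%N -> (k.+1 = #|B| + j)%N ->
     bmob B E1 != 0 -> Pr j (A :\: B) E2 -> Pr k A (E1 :|: E2)) ->
  forall k A E, gmob (eps k) A E != 0 -> Pr k A E.
Proof.
move=> Pr0 PrS k; elim/ltn_ind: k => k IHk A E nz.
case: (posnP k) => [k0|k0]; first by move: nz; rewrite k0 => /gmob_eps0[-> ->].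
have ltkA : (k < #|A|)%N.
  by rewrite ltnNge; apply: contraNN nz => /(gmob_eps_small E k0) ->.
have [B [E1 [E2 [BA /andP[ltB leB] <- nz1 nz2]]]] := gmob_eps_step ltkA nz.
apply: (PrS _ (k.+1 - #|B|)%N _ B) => //; first by rewrite subnKC.
by apply: IHk nz2; lia.
Qed.

(** A block has at most 2(|B| - 1) vertices and rank at most |B| - 1. The summand [(0 < k)] gives k
    + 1 for positive k and still admits the empty pair at k = 0. *)
Lemma gmob_eps_support k A E : gmob (eps k) A E != 0 ->
  [/\ ((0 < k) + k <= #|A|)%N, (#|A| <= 2 * k)%N & rank_le k E].
Proof.
move: k A E; apply: gmob_eps_ind => [|k j A B E1 E2 BA ltB kE nz1 [jA Aj rkj]].
  by rewrite cards0; split=> //; apply: rank_le0.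
have := subset_leq_card BA; rewrite cardsDS // in jA Aj => leBA.
split; [by lia | by lia |].
have [v vB] : exists v, v \in B by apply/set0Pn; rewrite -cards_eq0; lia.
have -> : k = (#|B|.-1 + j)%N by lia.
by apply: rank_leU rkj; apply: rank_le_block vB (bmob_subgraph nz1).
Qed.

(** * Supports for multiplicative polynomials *)

Hypothesis f_mult : multiplicative_graphpoly f.

Lemma fS_cut g c S X : const_on g X ->
  fS S X = fS (S :&: [set z | g z == c]) X * fS (S :\: [set z | g z == c]) X.
Proof.
move=> cX; rewrite -f_mult; apply/f_iso/sgraph_iso_sym.
rewrite -{3}(setID S [set z | g z == c]); apply: union_subgraph_iso.
  by rewrite -setI_eq0; apply/eqP/setP=> z; rewrite !inE; case: (g z == c); rewrite ?andbF.
move=> x y; rewrite !inE => /andP[_ /eqP gx] /andP[gy _]; apply: contra gy => /cX gxy.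
by rewrite -gx eq_sym; apply/eqP/gxy; rewrite !inE eqxx ?orbT.
Qed.

(** A labelling that separates two vertices of B splits the polynomial into two factors without
    constant term, so the coefficient of x is 0. *)
Lemma bmob_connected B E : bmob B E != 0 -> connected_on E B.
Proof.
move=> nz g cE x y xB yB; apply: contrapT => /eqP neg; case/eqP: nz.
apply: mob_eq0 => X XE; rewrite -/(fS B X) (fS_cut (g x) B (const_onS XE cE)).
have nz1 : B :&: [set z | g z == g x] != set0.
  by apply/set0Pn; exists x; rewrite !inE xB eqxx.
have nz2 : B :\: [set z | g z == g x] != set0.
  by apply/set0Pn; exists y; rewrite !inE yB eq_sym neg.
by rewrite coefM big_ord_recl big_ord1 !coef0_fS // mul0r mulr0 addr0.
Qed.

(** D takes one vertex from each block; blocks are connected, and |A| - k counts them. *)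
Lemma gmob_eps_reaches k A E : gmob (eps k) A E != 0 ->
  exists2 D : {set G}, (#|D| + k <= #|A|)%N & reaches E D A.
Proof.
move: k A E; apply: gmob_eps_ind => [|k j A B E1 E2 BA ltB kE nz1 [D leD rD]].
  by exists set0 => [|g _ x]; rewrite ?cards0 // inE.
have [v vB] : exists v, v \in B by apply/set0Pn; rewrite -cards_eq0; lia.
exists (v |: D).
  have := subset_leq_card BA; rewrite cardsDS // in leD => leBA.
  by rewrite cardsU1; have := leq_b1 (v \notin D); lia.
move=> g cE x xA; have [xB|nxB] := boolP (x \in B).
  exists v; first exact: setU11.
  exact: (bmob_connected nz1 (const_onS (subsetUl _ _) cE) xB vB).
have [|d dD ->] := rD g (const_onS (subsetUr _ _) cE) x; first by rewrite inE nxB.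
by exists d; rewrite // in_setU1 dD orbT.
Qed.

Lemma gmob_eps_covered k A E : gmob (eps k) A E != 0 ->
  forall x, x \in A -> exists2 e : {set G}, e \in E & x \in e.
Proof.
move: k A E; apply: gmob_eps_ind => [x|k j A B E1 E2 BA ltB kE nz1 IH x xA].
  by rewrite inE.
have [xB|nxB] := boolP (x \in B); last first.
  have [|e eE xe] := IH x; first by rewrite inE nxB.
  by exists e; rewrite // inE eE orbT.
have [y yB] : exists y, y \in B :\ x.
  by apply/set0Pn; rewrite -cards_eq0; have := cardsD1 x B; rewrite xB; lia.
rewrite !inE eq_sym in yB; case/andP: yB => nexy yB.
have [e eE xe] := connected_on_no_isolated (bmob_connected nz1) xB yB nexy.
by exists e; rewrite // inE eE.
Qed.

End FixedGround.
End ExponentialType.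

(** * Power sums *)

Section Newton.
Variable K : comNzRingType.
Implicit Type s : seq K.

(** The elementary symmetric function of s with the sign (-1)^k, zero beyond the length of s. *)
Definition top_coef k s : K :=
  if (k <= size s)%N then (\prod_(z <- s) ('X - z%:P))`_(size s - k) else 0.

Lemma top_coef0 s : top_coef 0 s = 1.
Proof.
rewrite /top_coef leq0n subn0 -(lead_coef_prod_XsubC s predT id) lead_coefE.
by rewrite size_prod_XsubC.
Qed.

Lemma top_coef_cons k z s :
  top_coef k.+1 (z :: s) = top_coef k.+1 s - z * top_coef k s.
Proof.
rewrite /top_coef /= ltnS subSS; case: (ltngtP k (size s)) => [ltks|ltsk|->].
- rewrite big_cons mulrBl coefB coefCM coefXM.
  rewrite (_ : (size s - k == 0)%N = false); last by apply/negbTE; lia.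
  by rewrite subnS.
- by rewrite mulr0 subr0.
by rewrite subnn big_cons mulrBl coefB coefCM coefXM.
Qed.

(** By [top_coef_cons] each summand is the difference of consecutive terms
    [top_coef i s * z ^+ (k.+1 - i)]. *)
Lemma newton_telescope k z s :
  \sum_(i < k.+1) top_coef i (z :: s) * z ^+ (k.+1 - i) = z * top_coef k s.
Proof.
elim: k => [|k IHk]; first by rewrite big_ord1 !top_coef0 mul1r mulr1.
rewrite big_ord_recr /= (eq_bigr (fun i : 'I_k.+1 =>
   z * (top_coef i (z :: s) * z ^+ (k.+1 - i)))); last first.
  by move=> i _; rewrite (subSn (ltnW (ltn_ord i))) exprS mulrCA.
by rewrite -mulr_sumr IHk top_coef_cons subSnn expr1; ring.
Qed.

(** Induction on s: the powers of the new root telescope, and the rest combines the identities for s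
    at [k.+1] and [k]. *)
Lemma newton_identity k s :
  \sum_(i < k) top_coef i s * (\sum_(z <- s) z ^+ (k - i)) + k%:R * top_coef k s = 0.
Proof.
elim: s k => [|z s IHs] k.
  rewrite big1 => [|i _]; last by rewrite big_nil mulr0.
  by case: k => [|k]; rewrite ?mul0r ?addr0 // /top_coef /= mulr0 addr0.
case: k => [|k]; first by rewrite big_ord0 mul0r addr0.
under eq_bigr do rewrite big_cons mulrDr.
rewrite big_split /= newton_telescope top_coef_cons.
have -> : \sum_(i < k.+1) top_coef i (z :: s) * (\sum_(z <- s) z ^+ (k.+1 - i))
   = \sum_(i < k.+1) top_coef i s * (\sum_(z <- s) z ^+ (k.+1 - i))
     - z * \sum_(i < k) top_coef i s * (\sum_(z <- s) z ^+ (k - i)).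
  rewrite !big_ord_recl /= !top_coef0 -addrA; congr (_ + _).
  rewrite mulr_sumr -sumrB; apply: eq_bigr => i _.
  by rewrite /bump add1n top_coef_cons subSS mulrBl mulrA.
rewrite (canRL (addrK _) (IHs k.+1)) (canRL (addrK _) (IHs k)) -natr1.
by ring.
Qed.

End Newton.

Section PowerSums.
Variables (R : realType) (f : sgraph -> {poly R[i]}).
Hypotheses (f_iso : iso_invariant f) (f_monic : monic_graphpoly f).
Hypothesis f_exp : exponential_type f.

Lemma root_prodE H :
  f H = \prod_(z <- sval (closed_field_poly_normal (f H))) ('X - z%:P).
Proof.
case: closed_field_poly_normal => s /= {1}->.
by have [/monicP -> _] := f_monic H; rewrite scale1r.
Qed.

Lemma eps_top_coef k H : eps f k H = top_coef k (sval (closed_field_poly_normal (f H))).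
Proof.
rewrite /eps /top_coef -root_prodE.
suff -> : #|H| = size (sval (closed_field_poly_normal (f H))) by [].
apply: succn_inj; have [_ <-] := f_monic H.
by rewrite {1}root_prodE size_prod_XsubC.
Qed.

Lemma root_psum_newton k H : (0 < k)%N -> root_psum f k H =
  - (\sum_(i < k | (0 < i)%N) eps f i H * root_psum f (k - i) H + k%:R * eps f k H).
Proof.
move=> k0; have := newton_identity k (sval (closed_field_poly_normal (f H))).
rewrite -eps_top_coef.
rewrite (eq_bigr (fun i : 'I_k => eps f i H * root_psum f (k - i) H)); last first.
  by move=> i _; rewrite eps_top_coef.
case: k k0 => // k _; rewrite (bigD1 ord0) //= eps0 // mul1r -addrA => /eqP.
rewrite addr_eq0 => /eqP ->; congr (- (_ + _)).
by apply: eq_bigl => i; rewrite lt0n.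
Qed.

Lemma root_psum_iso k G H : sgraph_iso G H -> root_psum f k G = root_psum f k H.
Proof. by move=> iso; rewrite /root_psum (f_iso iso). Qed.

Lemma root_psumD k G G1 G2 : f G = f G1 * f G2 ->
  root_psum f k G = root_psum f k G1 + root_psum f k G2.
Proof.
move=> fG; rewrite /root_psum -big_cat; apply: perm_big.
by apply: prod_XsubC_eq; rewrite big_cat /= -!root_prodE.
Qed.

(** In Newton's recursion the transform of a product lives on unions of supports, along which the
    size bounds 2i and 2(k - i) and the rank bounds add up. *)
Lemma gmob_psum_support k (G : sgraph) (A : {set G}) E :
  (0 < k)%N -> gmob (root_psum f k) A E != 0 ->
  [/\ (2 <= #|A|)%N, (#|A| <= 2 * k)%N & rank_le k E].
Proof.
elim/ltn_ind: k A E => k IHk A E k0 nz; apply: contrapT => no; case/eqP: nz.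
rewrite /gmob (eq_mob2 (F2 := fun S X =>
  (-1) * (\sum_(i < k | (0 < i)%N)
      eps f i (subgraph_graph (S, X)) * root_psum f (k - i) (subgraph_graph (S, X))
    + k%:R * eps f k (subgraph_graph (S, X))))); last first.
  by move=> S X _ _; rewrite mulN1r; apply: root_psum_newton.
rewrite mob2Z mob2D mob2Z mob2_sum big1 => [|i i0]; last first.
  apply/eqP; apply: contraT => /mob2M_neq0[A1 [A2 [E1 [E2 [A12 E12 nz1 nz2]]]]].
  have [lA1 uA1 rk1] := gmob_eps_support f_iso f_monic f_exp nz1.
  have [||lA2 uA2 rk2] := IHk (k - i)%N _ A2 E2 _ nz2; try by have := ltn_ord i; lia.
  case: no; rewrite -A12 -E12; split.
  - by apply: leq_trans lA2 (subset_leq_card (subsetUr _ _)).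
  - by apply: leq_trans (leq_card_setU _ _) _; have := ltn_ord i; lia.
  by have := rank_leU rk1 rk2; rewrite subnKC // ltnW.
rewrite add0r; apply/eqP; apply: contraT => nz; case: no.
have {}nz : gmob (eps f k) A E != 0.
  by apply: contraNneq nz => E0; rewrite -/(gmob (eps f k) A E) E0 !mulr0.
by have [lA uA rk] := gmob_eps_support f_iso f_monic f_exp nz; split=> //; lia.
Qed.

(** If a labelling separates x from y, the power sum splits along the label class of x into a part
    that ignores y and a part that ignores x; both transforms vanish. *)
Lemma gmob_psum_connected k (G : sgraph) (A : {set G}) E :
  multiplicative_graphpoly f -> gmob (root_psum f k) A E != 0 -> connected_on E A.
Proof.
move=> f_mult nz g cE x y xA yA; apply: contrapT => /eqP neg; case/eqP: nz.
pose C := [set z | g z == g x].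
rewrite /gmob (eq_mob2 (F2 := fun S X => root_psum f k (subgraph_graph (S :&: C, X))
   + root_psum f k (subgraph_graph (S :\: C, X)))); last first.
  move=> S X _ XE; apply: root_psumD.
  exact: (fS_cut f_iso f_mult (g x) S (const_onS XE cE)).
rewrite mob2D (mob2_indepl yA) ?(mob2_indepl xA) ?addr0 // => S X _ _.
  by rewrite setDDl setUC (_ : C :|: [set x] = C) //; apply/setUidPl; rewrite sub1set inE.
rewrite setIDAC (_ : S :&: C :\ y = S :&: C) //; apply/setDidPl.
by rewrite disjoint_sym disjoints1 !inE eq_sym (negbTE neg) andbF.
Qed.

End PowerSums.

Theorem theorem5p6 (R : realType) (f : sgraph -> {poly R[i]})
    (f_iso : iso_invariant f) (f_monic : monic_graphpoly f)
    (f_exp : exponential_type f) (k : nat) (k_ge1 : (1 <= k)%N) :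
  (subgraph_count_comb
     (fun H => (k + 1 <= #|H| <= 2 * k)%N /\ (#|H| - num_components H <= k)%N)
     (root_esym f k)
   /\
   subgraph_count_comb
     (fun H => (2 <= #|H| <= 2 * k)%N /\ (#|H| - num_components H <= k)%N)
     (root_psum f k))
  /\
  (multiplicative_graphpoly f ->
   subgraph_count_comb
     (fun H => no_isolated_vertex H /\ (#|H| - num_components H)%N = k)
     (root_esym f k)
   /\
   subgraph_count_comb
     (fun H => connected_graph H /\ (2 <= #|H| <= k + 1)%N)
     (root_psum f k)).
Proof.
have esymE H : root_esym f k H = (-1) ^+ k * eps f k H.
  by rewrite /root_esym /eps; case: ifP; rewrite ?mulr0.
have esym_iso G H : sgraph_iso G H -> root_esym f k G = root_esym f k H.
  by move=> iso; rewrite !esymE (eps_iso f_iso k iso).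
have esym_nz (G : sgraph) (A : {set G}) E :
    gmob (root_esym f k) A E != 0 -> gmob (eps f k) A E != 0.
  apply: contraNneq => E0; rewrite /gmob.
  rewrite (eq_mob2 (F2 := fun S X => (-1) ^+ k * eps f k (subgraph_graph (S, X)))).
    by rewrite mob2Z -/(gmob (eps f k) A E) E0 mulr0.
  by move=> S X _ _; apply: esymE.
have psum_iso := @root_psum_iso _ _ f_iso k.
have cardSG (G : sgraph) (P : {set G} * {set {set G}}) : #|subgraph_graph P| = #|P.1|.
  by rewrite card_sig.
split; [split | move=> f_mult; split].
- apply: (comb_of_support (N := 2 * k)) => // G P subP /esym_nz nz.
  have [lA uA rk] := gmob_eps_support f_iso f_monic f_exp nz.
  by split=> //; split; [rewrite cardSG; lia | exact: num_components_ge].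
- apply: (comb_of_support (N := 2 * k)) => // G P subP nz.
  have [lA uA rk] := gmob_psum_support f_iso f_monic f_exp k_ge1 nz.
  by split=> //; split; [rewrite cardSG; lia | exact: num_components_ge].
- apply: (comb_of_support (N := 2 * k)) => // G P subP /esym_nz nz.
  have [lA uA rk] := gmob_eps_support f_iso f_monic f_exp nz.
  split=> //; split.
    move=> x; have /andP[/subsetP P2 /forall_inP P12] := subP.
    have [e eP xe] := gmob_eps_covered f_iso f_monic f_exp f_mult nz (sgvalP x).
    have [a [b [_ neab eE]]] := edges_elim (P2 e eP).
    have [c nexc {}eE] : exists2 c, sgval x != c & e = [set sgval x; c].
      move: xe; rewrite eE !inE => /pred2P[->|->]; first by exists b.
      by exists a; rewrite 1?eq_sym // setUC.
    have /sgval_surj[y yE] : c \in P.1 by apply: (subsetP (P12 e eP)); rewrite eE set22.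
    exists y; rewrite sgval_adj yE -eE eP andbT.
    by apply: contraNneq nexc => ->; rewrite yE.
  (* D bounds the number of components above by |A| - k, the rank bounds it below by the same
     number. *)
  have [D leD rD] := gmob_eps_reaches f_iso f_monic f_exp f_mult nz.
  have := num_components_le subP rD; have := num_components_ge rk.
  by rewrite cardSG; lia.
- apply: (comb_of_support (N := 2 * k)) => // G P subP nz.
  have [lA uA rk] := gmob_psum_support f_iso f_monic f_exp k_ge1 nz.
  have conn := gmob_psum_connected f_iso f_monic f_mult nz.
  have /set0Pn[v vP] : P.1 != set0 by rewrite -cards_eq0; lia.
  split=> //; split; first by apply: connected_on_graph conn => //; apply/set0Pn; exists v.
  (* With a single component the rank bound reads |A| - 1 <= k. *)
  have /(num_components_le subP) : reaches P.2 [set v] P.1.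
    by move=> g cg x xP; exists v; rewrite ?set11 //; apply: conn.
  by have := num_components_ge rk; rewrite cards1 cardSG; lia.
Qed.
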